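(* Let $G$ be a profinite group. The category ${}_G^d\mathrm{Mod}$ of discrete $G$-modules has non-zero projective objects if and only if $G$ is finite.
   Context: A discrete $G$-module is a (left) $G$-module $M$ (an abelian group with a $\mathbb{Z}$-linear left action of $G$) such that the action map $G\times M\to M$ is continuous when $M$ is equipped with the discrete topology; equivalently, $M=\bigcup_{H} M^H$, where $H$ runs over the open normal subgroups of $G$ and $M^H$ is the submodule of elements fixed by every element of $H$. ${}_G^d\mathrm{Mod}$ denotes the category of discrete $G$-modules, a full subcategory of the category of all left $G$-modules (left $\mathbb{Z}[G]$-modules). It is a Grothendieck category, closed under subobjects, quotients and coproducts in the category of all $G$-modules. ''Projective'' means projective as an object of ${}_G^d\mathrm{Mod}$. *)

(* Defs.v *)
From HB Require Import structures.
From mathcomp Require Import all_boot all_order all_algebra.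
From mathcomp Require Import all_classical all_reals topology.

Set Implicit Arguments.
Unset Strict Implicit.
Unset Printing Implicit Defensive.

Import GRing.Theory.
Local Open Scope classical_set_scope.
Local Open Scope ring_scope.

HB.mixin Record isTopologicalGroup G & Topological G & Group G := {
  mulg_continuous : continuous (fun p : G * G => (p.1 * p.2)%g);
  invg_continuous : continuous (fun g : G => g^-1%g)
}.

#[short(type="topologicalGroupType")]
HB.structure Definition TopologicalGroup :=
  {G of isTopologicalGroup G & Topological G & Group G}.

Definition profinite (G : topologicalGroupType) : Prop :=
  [/\ compact [set: G], hausdorff_space G & totally_disconnected [set: G]].

HB.mixin Record isGModule (G : groupType) M & GRing.Zmodule M := {
  gact : G -> M -> M;
  gact1 : forall x : M, gact 1%g x = x;
  gactM : forall (g h : G) (x : M), gact (g * h)%g x = gact g (gact h x);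
  gactD : forall (g : G) (x y : M), gact g (x + y) = gact g x + gact g y
}.

#[short(type="gmodType")]
HB.structure Definition GModule (G : groupType) :=
  {M of isGModule G M & GRing.Zmodule M}.

HB.mixin Record GModule_isDiscrete (G : topologicalGroupType) M
    & GModule G M := {
  gact_continuous :
    continuous ((fun p => gact p.1 p.2)
      : G * discrete_topology M -> discrete_topology M)
}.

#[short(type="discreteGModType")]
HB.structure Definition DiscreteGModule (G : topologicalGroupType) :=
  {M of GModule_isDiscrete G M & GModule G M}.

HB.mixin Record isGEquivariant (G : groupType) (M N : gmodType G)
    (f : M -> N) := {
  gactE : forall (g : G) (x : M), f (gact g x) = gact g (f x)
}.

HB.structure Definition GModHom (G : groupType) (M N : gmodType G) :=
  {f of isGEquivariant G M N f & @Algebra.Additive M N f}.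

Notation "{ 'gmod' M -> N }" := (GModHom.type M N)
  (at level 0, M at level 98, N at level 99, format "{ 'gmod'  M  ->  N }")
  : type_scope.

(* Discrete G-modules form a full subcategory of all G-modules, so their
   morphisms are all the G-module morphisms; only the test objects of the two
   notions below are restricted to be discrete. *)

Definition epimorphism (G : topologicalGroupType) (M N : discreteGModType G)
    (e : {gmod M -> N}) : Prop :=
  forall (L : discreteGModType G) (u v : {gmod N -> L}),
    u \o e =1 v \o e -> u =1 v.

Definition projective (G : topologicalGroupType) (P : discreteGModType G)
    : Prop :=
  forall (M N : discreteGModType G) (e : {gmod M -> N}) (f : {gmod P -> N}),
    epimorphism e -> exists h : {gmod P -> M}, e \o h =1 f.

(* Main.v *)
Require Import Defs.
From HB Require Import structures.
From mathcomp Require Import all_boot all_order all_algebra.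
From mathcomp Require Import all_classical all_reals topology.
From mathcomp Require Import finmap freeg.

Set Implicit Arguments.
Unset Strict Implicit.
Unset Printing Implicit Defensive.

Import GRing.Theory.
Local Open Scope classical_set_scope.
Local Open Scope ring_scope.
Local Open Scope quotient_scope.

(** If G is finite, it is discrete, so the group ring Z[G] is a discrete
    module; it is free on one generator as a G-module, and epimorphisms of
    discrete modules are surjective (the cokernel of a morphism is again
    discrete), so Z[G] is projective.

    Suppose conversely that P is projective and x in P is non-zero.  Every
    discrete G-set X yields a discrete permutation module Z[X], and P itself is
    such a set.  Projectivity splits the canonical surjection Z[P] -> P by some
    s, and s x has a non-zero coefficient k at some y in P.  Let W be an open
    normal subgroup fixing both x and y.  For each open normal V inside W,
    projectivity lifts s to h : P -> Z[P * G/V] along the map forgetting the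
    second coordinate, so that

      k = sum over t in G/V of the coefficient of (y, t) in h x.

    As W fixes x and y, these coefficients are constant on the W-orbits of G/V.
    Because V acts trivially on G/V and W/V freely, all these orbits have
    #|W : V| elements, whence #|W : V| divides k ([invariant_sum_divisible]).
    If G is infinite, V can be chosen so that this index exceeds the absolute
    value of k ([open_normal_large_index]), which is absurd.

    The topological input is the supply of open normal subgroups.  A compact
    Hausdorff totally disconnected space has enough clopen sets
    ([compact_totally_disconnected_zero_dimensional]), and each clopen set
    containing 1 contains an open normal subgroup ([clopen_core]). *)

(** * Quasi-components of compact Hausdorff spaces *)

Section ZeroDimensional.
Variable T : topologicalType.
Hypotheses (cptT : compact [set: T]) (hsT : hausdorff_space T).

Definition quasi_component (x : T) : set T :=
  \bigcap_(C in [set C : set T | clopen C /\ C x]) C.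

Lemma closed_quasi_component x : closed (quasi_component x).
Proof. by apply: closed_bigI => C [[]]. Qed.

(** The finite intersections of clopen neighbourhoods of x shrink to the
    quasi-component, so by compactness one of them already avoids the closed
    complement of O. *)
Lemma quasi_component_clopen_nbhs x (O : set T) :
  open O -> quasi_component x `<=` O ->
  exists C, [/\ clopen C, C x & C `<=` O].
Proof.
move=> oO qO.
pose F := filter_from [set C : set T | clopen C /\ C x] id.
have FF : Filter F.
  apply: filter_from_filter; first by exists setT; split=> //; exact: clopenT.
  by move=> A B [? ?] [? ?]; exists (A `&` B) => //; split=> //; exact: clopenI.
have PF : ProperFilter F by apply: filter_from_proper => C [_ Cx]; exists x.
have cptO : compact (~` O).
  by apply: (subclosed_compact _ cptT) => //; exact: open_closedC.
have /compact_near_coveringP := cptO.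
move=> /(_ _ (powerset_filter_from F) (fun C y => ~ C y)
  (powerset_filter_from_filter PF)) [].
  move=> y Oy.
  have : ~ quasi_component x y by move=> /qO.
  move=> /existsNP[C /not_implyP[[[oC cC] Cx] Cy]].
  exists (~` C, [set D | D `<=` C]); first split => /=.
  - by apply: open_nbhs_nbhs; split => //; exact: closed_openC.
  - apply/near_powerset_filter_fromP; first by move=> ? ?; exact: subset_trans.
    by exists C => //; exists C.
  - by case=> z D [/= Cz DC] /DC.
move=> D [DF _ [C DC]] /(_ _ DC) CO.
have [E [clE Ex] EC] := DF _ DC.
exists E; split => // z /EC Cz; apply: contrapT => Oz; exact: (CO z).
Qed.

(** A splitting of the quasi-component Q into disjoint closed pieces extends, by
    normality, to disjoint open sets U and W of the whole space.  A clopen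
    neighbourhood E of x inside the union of U and W meets U, and meets W, in a
    clopen set, so Q lies in the one of these that contains x. *)
Lemma quasi_component_connected x : connected (quasi_component x).
Proof.
move=> B [b Bb] [C oC BC] [D cD BD].
have cq : closed (quasi_component x) by exact: closed_quasi_component.
have xq : quasi_component x x by move=> ? [].
have cB : closed B by rewrite BD; exact: closedI.
have cB' : closed (quasi_component x `&` ~` C).
  by apply: closedI => //; exact: open_closedC.
have /(_ (~` (quasi_component x `&` ~` C))) [|O nO clO] :=
    compact_normal hsT cptT cB.
  apply/set_nbhsP; exists (~` (quasi_component x `&` ~` C)); split => //.
    exact: closed_openC.
  by rewrite {1}BC => z [qz Cz] [_ /(_ Cz)].
have [U [oU BU UO]] := iffLR (set_nbhsP _ _) nO.
pose W := ~` closure U.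
have oW : open W by apply: closed_openC; exact: closed_closure.
have UW z : U z -> W z -> False by move=> /subset_closure Uz /(_ Uz).
have qUW z : quasi_component x z -> ~ B z -> W z.
  rewrite BC => qz Bz /(closure_subset UO) /clO; apply.
  by split=> // Cz; exact: Bz.
have [|E [[oE cE] Ex EUW]] :=
    @quasi_component_clopen_nbhs x (U `|` W) (openU oU oW).
  by move=> z qz; have [/BU|/(qUW z qz)] := pselect (B z); [left|right].
have [Bx|nBx] := pselect (B x).
  have clEU : clopen (E `&` U).
    split; first exact: openI.
    have -> : E `&` U = E `&` ~` W.
      apply/seteqP; split=> z [Ez]; first by move=> /UW Wz; split.
      by move=> /contrapT; have [] := EUW z Ez; [split|].
    by apply: closedI => //; exact: open_closedC.
  apply/seteqP; split=> z; first by rewrite BC => -[].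
  move=> qz; apply: contrapT => /(qUW _ qz); apply: UW.
  by case: (qz (E `&` U)) => //; split => //; split => //; exact: BU.
have clEW : clopen (E `&` W).
  split; first exact: openI.
  have -> : E `&` W = E `&` ~` U.
    apply/seteqP; split=> z [Ez Wz]; split => //; first by move=> /UW; exact.
    by have [] := EUW z Ez.
  by apply: closedI => //; exact: open_closedC.
have qb : quasi_component x b by move: Bb; rewrite BC => -[].
have [_ Wb] : (E `&` W) b by apply: qb; split => //; split => //; exact: qUW.
by case: (UW b) => //; exact: BU.
Qed.

Lemma compact_totally_disconnected_zero_dimensional :
  totally_disconnected [set: T] -> zero_dimensional T.
Proof.
move=> tdT x y xy.
have : ~ quasi_component x y.
  move=> qy; have : connected_component [set: T] x y.
    exists (quasi_component x) => //.
    split => //; last exact: quasi_component_connected.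
    by move=> C [].
  by rewrite tdT // => /= yx; move: xy; rewrite yx eqxx.
by move=> /existsNP[C /not_implyP[[clC Cx] Cy]]; exists C.
Qed.

End ZeroDimensional.

(** * Open normal subgroups of a compact group *)

Lemma continuous_mulg (G : topologicalGroupType) (T : topologicalType)
  (u v : T -> G) : continuous u -> continuous v ->
  continuous (fun t => (u t * v t)%g).
Proof.
move=> uc vc t.
apply: (@continuous_comp _ _ _ (fun t => (u t, v t))
  (fun p : G * G => (p.1 * p.2)%g)); last exact: mulg_continuous.
by apply: cvg_pair; [exact: uc|exact: vc].
Qed.

Lemma lmulg_continuous (G : topologicalGroupType) (g : G) :
  continuous (fun h : G => (g * h)%g).
Proof. by apply: continuous_mulg => h; [exact: cvg_cst|exact: cvg_id]. Qed.

Section OpenNormalSubgroups.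
Variable G : topologicalGroupType.
Implicit Types V W : set G.

Record open_normal V : Prop := OpenNormal {
  open_normal_open : open V;
  open_normal1 : V 1%g;
  open_normalM : forall g h, V g -> V h -> V (g * h)%g;
  open_normalV : forall g, V g -> V g^-1%g;
  open_normalJ : forall g h, V g -> V (h^-1 * g * h)%g
}.

(** The intersection of all the conjugates of the stabiliser of U under left
    translation; two-sided quantification makes it visibly normal. *)
Definition clopen_core (U : set G) : set G :=
  [set g | forall a b, U (a * g * b)%g <-> U (a * b)%g].

Hypothesis cptG : compact [set: G].

(** The tube lemma: near each (a, b) and for g near 1, both a g b and a b fall
    on the same side of U, and compactness of G * G makes the neighbourhood of 1
    uniform in a and b. *)
Lemma clopen_core_near1 (U : set G) : clopen U ->
  \forall g \near (1%g : G), clopen_core U g.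
Proof.
move=> clU.
have cptGG : compact [set: G * G] by rewrite -setXTT; exact: compact_setX.
pose P (g : G) (p : G * G) := U (p.1 * g * p.2)%g <-> U (p.1 * p.2)%g.
pose f (q : (G * G) * G) := (q.1.1 * q.2 * q.1.2)%g.
pose f1 (q : (G * G) * G) := (q.1.1 * q.1.2)%g.
have fst2_cont : continuous (fun q : (G * G) * G => q.1.1).
  by move=> q; apply: continuous_comp; exact: cvg_fst.
have snd2_cont : continuous (fun q : (G * G) * G => q.1.2).
  by move=> q; apply: continuous_comp; [exact: cvg_fst|exact: cvg_snd].
have f_cont : continuous f.
  apply: continuous_mulg snd2_cont; apply: continuous_mulg fst2_cont _.
  by move=> q; exact: cvg_snd.
have f1_cont : continuous f1 by exact: continuous_mulg.
have PG : \forall g \near (1%g : G), forall p, [set: G * G] p -> P g p.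
  have /compact_near_coveringP := cptGG.
  apply => -[a b] _.
  have near_f C : open C -> C (a * b)%g ->
      \forall q \near ((a, b), 1%g : G), C (f q) /\ C (f1 q).
    move=> oC Cab; have Cn : nbhs (a * b)%g C by exact: open_nbhs_nbhs.
    apply: filterI; last exact: (f1_cont ((a, b), 1%g)).
    by apply: (f_cont ((a, b), 1%g)); rewrite /f /= mulg1.
  have [oU cU] := clU.
  have [Uab|Uab] := pselect (U (a * b)%g).
    by apply: filterS (near_f U oU Uab) => -[p g] /= [? ?]; split.
  by apply: filterS (near_f _ (closed_openC cU) Uab) => -[p g] /= [? ?]; split.
by apply: filterS PG => g Pg c d; exact: (Pg (c, d)).
Qed.

Lemma clopen_core_open_normal (U : set G) :
  clopen U -> open_normal (clopen_core U).
Proof.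
move=> clU; have cM g h : clopen_core U g -> clopen_core U h ->
    clopen_core U (g * h)%g.
  by move=> Ug Uh a b; rewrite (mulgA a); exact: iff_trans (Uh _ _) (Ug _ _).
split.
- rewrite openE => g Ug; rewrite /interior.
  have : \forall h \near g, clopen_core U (g^-1 * h)%g.
    have := @lmulg_continuous G g^-1%g g (clopen_core U).
    by rewrite mulVg; apply; exact: clopen_core_near1.
  by apply: filterS => h /= Uh; rewrite -(mulVKg g h); exact: cM.
- by move=> a b; rewrite mulg1.
- exact: cM.
- by move=> g Ug a b; have := iff_sym (Ug (a * g^-1)%g b); rewrite mulgVK.
- move=> g h Ug a b.
  have := Ug (a * h^-1)%g (h * b)%g; rewrite !mulgA.
  by rewrite mulgVK.
Qed.

Lemma clopen_core_sub (U : set G) : U 1%g -> clopen_core U `<=` U.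
Proof. by move=> U1 g /(_ 1%g 1%g); rewrite !mulg1 mul1g => /iffRL; apply. Qed.

Lemma open_normal_translate V (g : G) : open_normal V ->
  \forall h \near g, V (g^-1 * h)%g.
Proof.
move=> [oV V1 _ _ _]; have := @lmulg_continuous G g^-1%g g V.
by rewrite mulVg; apply; exact: open_nbhs_nbhs.
Qed.

(** The complement is a union of cosets. *)
Lemma open_normal_clopen V : open_normal V -> clopen V.
Proof.
move=> nV; split; first exact: open_normal_open.
rewrite -openC openE => g Vg; apply: filterS (open_normal_translate g nV).
move=> h Vgh Vh; apply: Vg.
have := open_normalM nV Vh (open_normalV nV Vgh).
by rewrite invgM invgK mulVKg.
Qed.

(** A finite type in bijection with G/V.  The representatives are part of the
    data so that functions on cosets can be defined without a quotient of G. *)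
Record coset_space V := CosetSpace {
  coset_type :> finType;
  coset_class : G -> coset_type;
  coset_rep : coset_type -> G;
  coset_repK : cancel coset_rep coset_class;
  coset_classP : forall a b,
    coset_class a = coset_class b <-> V (a^-1 * b)%g
}.

Arguments coset_class {V} _ _.
Arguments coset_classP {V} _ _ _.

(** Finitely many cosets d V cover G; which of them contain g is a finite
    amount of information that determines the coset of g. *)
Lemma open_normal_coset_space V : open_normal V -> inhabited (coset_space V).
Proof.
move=> [oV V1 VM VV VJ].
have lopen (g : G) : open [set h | V (g^-1 * h)%g].
  by apply: open_comp oV => h _; exact: lmulg_continuous.
(* The covering form of compactness is stated for pointed spaces. *)
pose pG : ptopologicalType :=
  HB.pack (TopologicalGroup.sort G)
    (isPointed.Build (TopologicalGroup.sort G) 1%g).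
have : cover_compact [set: pG] by rewrite -compact_cover.
move=> /(_ G setT (fun g => [set h | V (g^-1 * h)%g])) [].
- by move=> g _; exact: lopen.
- by move=> g _; exists g => //=; rewrite mulVg.
move=> D _ covD.
pose trace (h : G) : {ffun D -> bool} :=
  [ffun d : D => `[< V ((val d)^-1 * h)%g >]].
have traceE a b : trace a = trace b <-> V (a^-1 * b)%g.
  split=> [ab|Vab]; last first.
    apply/ffunP => d; rewrite !ffunE; apply/asbool_equiv_eq; split=> Vd.
      by have := VM _ _ Vd Vab; rewrite -mulgA mulVKg.
    have := VM _ _ Vd (VV _ Vab); rewrite invgM invgK -!mulgA.
    by rewrite mulVKg.
  have [d dD /= Vda] := covD a I.
  have Vdb : V (d^-1 * b)%g.
    move/ffunP/(_ [` dD ]%fset): ab; rewrite !ffunE /= => ab.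
    by apply/asboolP; rewrite -ab; exact/asboolP.
  have := VM _ _ (VV _ Vda) Vdb.
  by rewrite invgM invgK -!mulgA mulVKg.
pose T := {t : {ffun D -> bool} | `[< exists h, trace h = t >]}.
have trP h : `[< exists h', trace h' = trace h >] by apply/asboolP; exists h.
pose cl h : T := exist _ (trace h) (trP h).
have /choice[rep repK] : forall t : T, exists h, cl h = t.
  by move=> [t /[dup] /asboolP[h <-] ht]; exists h; exact: val_inj.
apply: inhabits; apply: (@CosetSpace V T cl rep repK) => a b; rewrite -traceE.
by split=> [/(congr1 val)|ab] //; exact: val_inj.
Qed.

End OpenNormalSubgroups.

(** * The action on a finite coset space *)

Section CosetAction.
Variables (G : topologicalGroupType) (V : set G).
Variable T : coset_space V.

Definition coset_act (g : G) (t : T) : T := coset_class T (g * coset_rep t)%g.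

Lemma coset_act_class g a :
  coset_act g (coset_class T a) = coset_class T (g * a)%g.
Proof.
apply/(coset_classP T); rewrite invgM -mulgA mulKg.
by apply/(coset_classP T); rewrite coset_repK.
Qed.

Lemma coset_act1 t : coset_act 1%g t = t.
Proof. by rewrite /coset_act mul1g coset_repK. Qed.

Lemma coset_actM g h t : coset_act (g * h)%g t = coset_act g (coset_act h t).
Proof. by rewrite -(coset_repK t) !coset_act_class mulgA. Qed.

Lemma coset_act_bij g : bijective (coset_act g).
Proof.
by exists (coset_act g^-1%g) => t; rewrite -coset_actM ?mulVg ?mulgV coset_act1.
Qed.

Lemma coset_act_near t : open_normal V ->
  \forall g \near (1%g : G), coset_act g t = t.
Proof.
move=> V_normal; have : \forall g \near (1%g : G), V g.
  apply: open_nbhs_nbhs.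
  by split; [exact: open_normal_open|exact: open_normal1].
apply: filterS => g Vg; rewrite -[RHS]coset_repK.
apply/(coset_classP T); rewrite invgM.
by apply: open_normalJ => //; exact: open_normalV.
Qed.

End CosetAction.

Section InvariantSum.
Variables (G : topologicalGroupType) (V W : set G).
Hypotheses (W_normal : open_normal W) (VW : V `<=` W).
Variables (T : coset_space V) (S : coset_space W).

(* m is the index of V in W, read off as the number of V-cosets inside W. *)
Let r (t : T) : S := coset_class S (coset_rep t).
Let m := #|[pred t : T | r t == coset_class S 1%g]|.

(** Left translation by a representative of s carries the fibre over the trivial
    coset onto the fibre over s. *)
Lemma card_coset_fiber (s : S) : #|[pred t : T | r t == s]| = m.
Proof.
rewrite /m -!sum1_card (reindex (coset_act (coset_rep s))); last first.
  exact/onW_bij/coset_act_bij.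
apply: eq_bigl => t; rewrite !inE /r.
have -> : coset_class S (coset_rep (coset_act (coset_rep s) t)) =
    coset_class S (coset_rep s * coset_rep t)%g.
  by apply/(coset_classP S)/VW/(coset_classP T); rewrite coset_repK.
rewrite -{2}(coset_repK s).
apply/eqP/eqP => /(coset_classP S) Wst; apply/(coset_classP S).
  by move: Wst; rewrite invgM -mulgA mulVg.
by rewrite invgM -mulgA mulVg.
Qed.

Lemma card_coset_space : #|T| = (#|S| * m)%N.
Proof.
rewrite -sum1_card (partition_big r predT) //= -sum_nat_const.
by apply: eq_bigr => s _; rewrite sum1_card card_coset_fiber.
Qed.

(** The W-orbits in G/V are the fibres of the projection to G/W because W is
    normal, so a W-invariant function is pulled back from G/W and each of its
    values is taken m times. *)
Lemma invariant_sum_divisible (c : T -> int) :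
  (forall w t, W w -> c (coset_act w t) = c t) ->
  exists q : int, \sum_t c t = q *+ m.
Proof.
move=> c_inv; exists (\sum_(s : S) c (coset_class T (coset_rep s))).
rewrite (partition_big r predT) //= -sumrMnl; apply: eq_bigr => s _.
rewrite (eq_bigr (fun=> c (coset_class T (coset_rep s)))).
  by rewrite sumr_const card_coset_fiber.
move=> t /eqP rt; rewrite -(coset_repK t).
set a := coset_rep t; set b := coset_rep s.
have Wba : W (b^-1 * a)%g.
  by apply/(coset_classP S); rewrite coset_repK -rt.
have Wab : W (a * b^-1)%g.
  have := open_normalJ W_normal b^-1%g Wba.
  by rewrite invgK mulVKg.
by rewrite -(c_inv _ (coset_class T b) Wab) coset_act_class mulgVK.
Qed.

End InvariantSum.

(** * Open normal subgroups of large index *)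

Section SmallSubgroups.
Variable G : topologicalGroupType.
Hypothesis profG : profinite G.

Lemma profinite_zero_dimensional : zero_dimensional G.
Proof.
by case: profG; exact: compact_totally_disconnected_zero_dimensional.
Qed.

Lemma clopen_avoiding (W : set G) (s : seq G) :
  clopen W -> W 1%g -> 1%g \notin s ->
  exists U : set G,
    [/\ clopen U, U 1%g, U `<=` W & forall g, g \in s -> ~ U g].
Proof.
move=> clW W1; elim: s => [_|g s IHs]; first by exists W; split.
rewrite inE negb_or => /andP[g1 /IHs[U [clU U1 UW Us]]].
have [C [clC C1 Cg]] := profinite_zero_dimensional g1.
exists (U `&` C); split=> //; first exact: clopenI.
  by move=> h [/UW].
by move=> h; rewrite inE => /predU1P[-> []|/Us Uh []].
Qed.

(** Fix N distinct elements of G and take a clopen neighbourhood of 1 avoiding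
    all their quotients; its core has at least N cosets. *)
Lemma open_normal_large_index (W : set G) (N : nat) :
  infinite_set [set: G] -> open_normal W ->
  exists V, [/\ open_normal V, V `<=` W &
    forall T : coset_space V, (N <= #|T|)%N].
Proof.
move=> infG W_normal; have clW := open_normal_clopen W_normal.
have W1 := open_normal1 W_normal.
have [A _ NA] := infinite_set_fset N infG.
pose s := [seq g <- [seq (a^-1 * b)%g | a <- A, b <- A] | g != 1%g].
have [|U [clU U1 UW Us]] := @clopen_avoiding W s clW W1.
  by rewrite mem_filter eqxx.
have [cptG _ _] := profG.
exists (clopen_core U); split.
- exact: clopen_core_open_normal.
- exact: subset_trans (clopen_core_sub U1) UW.
move=> T; apply: leq_trans NA _.
have /card_uniqP : uniq [seq coset_class T a | a <- A].
  rewrite map_inj_in_uniq ?fset_uniq// => a b aA bA /(coset_classP T) Vab.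
  have Uab : U (a^-1 * b)%g by exact: clopen_core_sub Vab.
  apply/eqP; apply: contraPT Uab => ab; apply: Us; rewrite mem_filter.
  apply/andP; split; last by apply/allpairsP; exists (a, b).
  by apply: contra ab => /eqP/mulg1_eq; rewrite invgK => ->.
by rewrite size_map => <-; exact: max_card.
Qed.

End SmallSubgroups.

(** * Discrete modules and their epimorphisms *)

Section Discreteness.
Variable G : topologicalGroupType.

Lemma gact0 (M : gmodType G) (g : G) : gact g (0 : M) = 0.
Proof. by apply: (addrI (gact g 0)); rewrite -gactD !addr0. Qed.

Lemma gactN (M : gmodType G) (g : G) (x : M) : gact g (- x) = - gact g x.
Proof. by apply: (addrI (gact g x)); rewrite -gactD !subrr gact0. Qed.

(** On the neighbourhood g Stab(x) * {x} of (g, x) the action is constant. *)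
Lemma gact_continuous_of_stabilizers (M : gmodType G) :
  (forall x : M, \forall g \near (1%g : G), gact g x = x) ->
  continuous ((fun p => gact p.1 p.2)
    : G * discrete_topology M -> discrete_topology M).
Proof.
move=> Mst [g x]; apply/(@discrete_cvg (discrete_topology M)).
have gh : \forall h \near g, gact (g^-1 * h)%g x = x.
  have := @lmulg_continuous G g^-1%g g [set k | gact k x = x].
  by rewrite mulVg; apply; exact: Mst.
exists ([set h : G | gact (g^-1 * h)%g x = x], [set x]) => /=.
  by split; [exact: gh|exact: (@discrete_set1 (discrete_topology M))].
by move=> [h _] /= [hx ->]; rewrite -{2}hx -gactM mulVKg.
Qed.

Lemma clopen_stabilizer (M : discreteGModType G) (x : M) :
  clopen [set g : G | gact g x = x].
Proof.
pose act_x (g : G) : discrete_topology M := gact g x.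
have act_x_cont : continuous act_x.
  move=> g; apply/(@discrete_cvg (discrete_topology M)).
  have /(_ [set gact g x]) [] := @gact_continuous G M (g, x).
    exact: (@discrete_set1 (discrete_topology M)).
  move=> [A B] /= [gA xB] AB; apply: filterS gA => h Ah.
  apply: (AB (h, x)); split => //.
  exact: (@nbhs_singleton (discrete_topology M)).
have clopen_x : clopen [set x : discrete_topology M].
  by split; [exact: discrete_open|exact: discrete_closed].
exact: preimage_clopen clopen_x act_x_cont.
Qed.

Lemma near_stabilizer (M : discreteGModType G) (x : M) :
  \forall g \near (1%g : G), gact g x = x.
Proof.
apply: open_nbhs_nbhs; split; first by case: (clopen_stabilizer x).
exact: gact1.
Qed.

End Discreteness.

Section GModHomInstances.
Variable G : groupType.

Lemma idfun_gactE (M : gmodType G) (g : G) (x : M) :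
  idfun (gact g x) = gact g (idfun x).
Proof. by []. Qed.
HB.instance Definition _ (M : gmodType G) :=
  isGEquivariant.Build G M M idfun (@idfun_gactE M).
End GModHomInstances.

(** The cokernel of a morphism of discrete modules, which detects the failure of
    surjectivity within discrete modules. *)
Section Cokernel.
Variables (G : topologicalGroupType) (M N : discreteGModType G).
Variable e : {gmod M -> N}.

Definition in_image : pred N := fun y => `[< exists x, e x = y >].

Lemma in_imageP y : reflect (exists x, e x = y) (y \in in_image).
Proof. exact: asboolP. Qed.

Lemma in_image_zmod : zmod_closed in_image.
Proof.
split=> [|_ _ /in_imageP[x <-] /in_imageP[y <-]]; apply/in_imageP.
  by exists 0; rewrite raddf0.
by exists (x - y); rewrite raddfB.
Qed.
HB.instance Definition _ := GRing.isZmodClosed.Build N in_image in_image_zmod.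

Definition image_submodule := GRing.ZmodClosed.clone N in_image _.

Definition coker : Type := Quotient.quot image_submodule.
HB.instance Definition _ := GRing.Zmodule.on coker.

Definition coker_proj (y : N) : coker := \pi_(Quotient.quot image_submodule) y.

Lemma coker_projE y z : coker_proj y = coker_proj z <-> exists x, e x = y - z.
Proof.
split=> [/eqP|eyz]; last apply/eqP.
  by rewrite -(Quotient.idealrBE image_submodule) => /in_imageP.
by rewrite -(Quotient.idealrBE image_submodule); apply/in_imageP.
Qed.

Lemma coker_proj_is_additive : zmod_morphism coker_proj.
Proof. exact: (raddfB \pi_(Quotient.quot image_submodule)). Qed.
HB.instance Definition _ :=
  GRing.isZmodMorphism.Build N coker coker_proj coker_proj_is_additive.

Definition coker_gact (g : G) (q : coker) : coker :=
  coker_proj (gact g (repr (q : Quotient.quot image_submodule))).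

Lemma coker_reprK q : coker_proj (repr (q : Quotient.quot image_submodule)) = q.
Proof. exact: reprK. Qed.

Lemma coker_proj_gact g y : coker_proj (gact g y) = coker_gact g (coker_proj y).
Proof.
have /esym/coker_projE[x exy] := coker_reprK (coker_proj y).
by apply/coker_projE; exists (gact g x); rewrite gactE exy gactD gactN.
Qed.

Lemma coker_gact1 q : coker_gact 1%g q = q.
Proof. by rewrite /coker_gact gact1 coker_reprK. Qed.

Lemma coker_gactM g h q :
  coker_gact (g * h)%g q = coker_gact g (coker_gact h q).
Proof. by rewrite -(coker_reprK q) -!coker_proj_gact gactM. Qed.

Lemma coker_gactD g p q :
  coker_gact g (p + q) = coker_gact g p + coker_gact g q.
Proof.
rewrite -(coker_reprK p) -(coker_reprK q) -raddfD -!coker_proj_gact gactD.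
exact: raddfD.
Qed.

HB.instance Definition _ :=
  isGModule.Build G coker coker_gact1 coker_gactM coker_gactD.

Lemma coker_near_stabilizer (q : coker) :
  \forall g \near (1%g : G), gact g q = q.
Proof.
have := near_stabilizer (repr (q : Quotient.quot image_submodule)).
apply: filterS => g gq.
by rewrite /gact /= /coker_gact gq coker_reprK.
Qed.

HB.instance Definition _ := GModule_isDiscrete.Build G coker
  (gact_continuous_of_stabilizers coker_near_stabilizer).

HB.instance Definition _ := isGEquivariant.Build G N coker coker_proj
  coker_proj_gact.

Definition coker_zero (y : N) : coker := 0.
Lemma coker_zero_is_additive : zmod_morphism coker_zero.
Proof. by move=> x y; rewrite /coker_zero subrr. Qed.
HB.instance Definition _ :=
  GRing.isZmodMorphism.Build N coker coker_zero coker_zero_is_additive.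
Lemma coker_zero_gactE g y : coker_zero (gact g y) = gact g (coker_zero y).
Proof. by rewrite [RHS]gact0. Qed.
HB.instance Definition _ := isGEquivariant.Build G N coker coker_zero
  coker_zero_gactE.

(** The projection to the cokernel and the zero map agree after composition with
    e, so an epimorphism has zero cokernel. *)
Lemma epimorphism_surjective : epimorphism e -> forall y, exists x, e x = y.
Proof.
move=> epi_e y; have /coker_projE[x] : coker_proj y = coker_proj 0; last first.
  by rewrite subr0; exists x.
rewrite raddf0.
apply: (epi_e coker coker_proj coker_zero) => x /=.
rewrite -[coker_zero _](raddf0 coker_proj).
by apply/coker_projE; exists x; rewrite subr0.
Qed.

End Cokernel.

Lemma surjective_epimorphism (G : topologicalGroupType)
    (M N : discreteGModType G) (e : {gmod M -> N}) :
  (forall y, exists x, e x = y) -> epimorphism e.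
Proof. by move=> e_surj L u v uv y; have [x <-] := e_surj y; exact: uv. Qed.

(** * Permutation modules *)

Section FreeAbelianGroup.
Variable X : choiceType.

Lemma freeg_additive_ext (M : zmodType) (u v : {additive {freeg X} -> M}) :
  (forall x, u << x >> = v << x >>) -> u =1 v.
Proof.
move=> uv D; rewrite -(freeg_sumE D) !raddf_sum; apply: eq_bigr => z _.
by rewrite -[coeff z D]intz -freegU_mulz !raddfMz uv.
Qed.

Variables (M : zmodType) (f : X -> M).

(** The additive extension of f.  [fglift] wants a module over the coefficient
    ring, hence the detour through [zmodule], M seen as a module over int. *)
Definition zlift (D : {freeg X}) : M := fglift (f : X -> zmodule M) D.

Lemma zlift_is_additive : zmod_morphism zlift.
Proof. exact: (@lift_is_additive int X (zmodule M) f). Qed.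
HB.instance Definition _ :=
  GRing.isZmodMorphism.Build {freeg X} M zlift zlift_is_additive.

Lemma zliftU x : zlift << x >> = f x.
Proof. by rewrite /zlift liftU; exact: mulr1z. Qed.

End FreeAbelianGroup.

Record discreteGSet (G : topologicalGroupType) := DiscreteGSet {
  gset_sort :> choiceType;
  sact : G -> gset_sort -> gset_sort;
  sact1 : forall x, sact 1%g x = x;
  sactM : forall g h x, sact (g * h)%g x = sact g (sact h x);
  sact_near : forall x, \forall g \near (1%g : G), sact g x = x
}.

(** The discrete module Z[X] on a discrete G-set X.  It is a named copy of
    {freeg X}, where X carries the action, because the free abelian group only
    remembers the underlying type. *)
Section PermutationModule.
Variables (G : topologicalGroupType) (X : discreteGSet G).

Definition perm_module : Type := {freeg X}.
HB.instance Definition _ := GRing.Zmodule.on perm_module.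

Definition perm_basis (x : X) : perm_module := << x >>.
Definition perm_coeff (x : X) (D : perm_module) : int := coeff x D.
Definition perm_act (g : G) : perm_module -> perm_module :=
  zlift (fun x => perm_basis (sact g x)).

HB.instance Definition _ (x : X) :=
  GRing.Additive.copy (perm_coeff x) (coeff x).
HB.instance Definition _ (g : G) :=
  GRing.Additive.copy (perm_act g) (zlift (fun x => perm_basis (sact g x))).

Lemma perm_module_ext (M : zmodType) (u v : {additive perm_module -> M}) :
  (forall x, u (perm_basis x) = v (perm_basis x)) -> u =1 v.
Proof. exact: (@freeg_additive_ext X M u v). Qed.

Lemma perm_act_basis g x : perm_act g (perm_basis x) = perm_basis (sact g x).
Proof. exact: zliftU. Qed.

Lemma perm_act1 D : perm_act 1%g D = D.
Proof.
apply: (perm_module_ext (u := perm_act 1%g) (v := idfun)) => x /=.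
by rewrite perm_act_basis sact1.
Qed.

Lemma perm_actM g h D : perm_act (g * h)%g D = perm_act g (perm_act h D).
Proof.
apply: (perm_module_ext (u := perm_act (g * h)%g)
  (v := perm_act g \o perm_act h)) => x /=.
by rewrite !perm_act_basis sactM.
Qed.

Lemma perm_actD g D E : perm_act g (D + E) = perm_act g D + perm_act g E.
Proof. exact: raddfD. Qed.

HB.instance Definition _ :=
  isGModule.Build G perm_module perm_act1 perm_actM perm_actD.

Lemma gact_basis g x : gact g (perm_basis x) = perm_basis (sact g x).
Proof. exact: perm_act_basis. Qed.

Lemma sact_inj g : injective (@sact G X g).
Proof.
by apply: (can_inj (g := sact g^-1%g)) => x; rewrite -sactM mulVg sact1.
Qed.

Lemma perm_coeff_basis x y : perm_coeff y (perm_basis x) = (x == y)%:R.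
Proof. by rewrite /perm_coeff coeffU mul1r. Qed.

Lemma perm_coeff_gact g x (D : perm_module) :
  perm_coeff (sact g x) (gact g D) = perm_coeff x D.
Proof.
apply: (perm_module_ext (u := perm_coeff (sact g x) \o perm_act g)) => y /=.
by rewrite perm_act_basis !perm_coeff_basis (inj_eq (@sact_inj g)).
Qed.

(** An element involves finitely many basis vectors, and the intersection of
    finitely many open stabilisers is open. *)
Lemma perm_module_near (D : perm_module) :
  \forall g \near (1%g : G), gact g D = D.
Proof.
rewrite -(freeg_sumE D); elim/big_ind: _ => [|E F nE nF|x _].
- by apply: filterE => g; exact: gact0.
- by near do rewrite gactD (near nE) // (near nF) //.
rewrite -[coeff x D]intz -freegU_mulz.
have : \forall g \near (1%g : G), sact g x = x by exact: sact_near.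
apply: filterS => g gx.
rewrite [LHS](raddfMz (perm_act g) (coeff x D) (perm_basis x)) /=.
by rewrite perm_act_basis gx.
Unshelve. all: by end_near. Qed.

HB.instance Definition _ := GModule_isDiscrete.Build G perm_module
  (gact_continuous_of_stabilizers perm_module_near).

Section UniversalProperty.
Variables (M : gmodType G) (f : X -> M).
Hypothesis f_gact : forall g x, f (sact g x) = gact g (f x).

(** The proof of equivariance is an argument so that the extension can be a
    morphism of G-modules by inference. *)
Definition perm_lift_fun & (forall g x, f (sact g x) = gact g (f x)) :
  perm_module -> M := zlift f.
Local Notation perm_lift := (perm_lift_fun f_gact).

HB.instance Definition _ := GRing.Additive.copy perm_lift (zlift f).

Lemma perm_lift_gact g D : perm_lift (gact g D) = gact g (perm_lift D).
Proof.
have act_zmod : zmod_morphism (gact g : M -> M).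
  by move=> x y; rewrite gactD gactN.
pose act : {additive M -> M} :=
  HB.pack (gact g : M -> M) (GRing.isZmodMorphism.Build _ _ _ act_zmod).
apply: (perm_module_ext (u := perm_lift \o perm_act g) (v := act \o perm_lift))
  => x /=.
by rewrite perm_act_basis /perm_lift_fun !zliftU f_gact.
Qed.
HB.instance Definition _ :=
  isGEquivariant.Build G perm_module M perm_lift perm_lift_gact.

Lemma perm_lift_basis x : perm_lift (perm_basis x) = f x.
Proof. exact: zliftU. Qed.

End UniversalProperty.
End PermutationModule.

(** * Discrete G-sets *)

Section GSets.
Variable G : topologicalGroupType.

Definition module_gset (M : discreteGModType G) : discreteGSet G :=
  DiscreteGSet (@gact1 G M) (@gactM G M) (@near_stabilizer G M).

Variables X Y : discreteGSet G.

Definition prod_act (g : G) (z : X * Y) : X * Y := (sact g z.1, sact g z.2).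

Lemma prod_act1 z : prod_act 1%g z = z.
Proof. by case: z => x y; rewrite /prod_act !sact1. Qed.

Lemma prod_actM g h z : prod_act (g * h)%g z = prod_act g (prod_act h z).
Proof. by rewrite /prod_act !sactM. Qed.

Lemma prod_act_near z : \forall g \near (1%g : G), prod_act g z = z.
Proof.
case: z => x y; have xn := sact_near x; have yn := sact_near y.
by apply: filterS2 xn yn => g gx gy; rewrite /prod_act gx gy.
Qed.

Definition prod_gset : discreteGSet G :=
  DiscreteGSet prod_act1 prod_actM prod_act_near.

End GSets.

Definition coset_gset (G : topologicalGroupType) (V : set G)
    (V_normal : open_normal V) (T : coset_space V) : discreteGSet G :=
  DiscreteGSet (@coset_act1 G V T) (@coset_actM G V T)
    (fun t => coset_act_near t V_normal).

(** * Projective modules over an infinite group vanish *)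

Section PushforwardFirst.
Variables (G : topologicalGroupType) (X Y : discreteGSet G).

Lemma push_fst_gact (g : G) (z : prod_gset X Y) :
  perm_basis (sact g z).1 = gact g (perm_basis z.1).
Proof. by rewrite gact_basis. Qed.

Definition push_fst : {gmod perm_module (prod_gset X Y) -> perm_module X} :=
  perm_lift_fun push_fst_gact.
End PushforwardFirst.

Section Counit.
Variables (G : topologicalGroupType) (M : discreteGModType G).

Lemma counit_gact (g : G) (x : module_gset M) :
  idfun (sact g x : M) = gact g (idfun (x : M)).
Proof. by []. Qed.

Definition counit : {gmod perm_module (module_gset M) -> M} :=
  perm_lift_fun (X := module_gset M) counit_gact.

Lemma counit_basis (x : M) : counit (perm_basis (x : module_gset M)) = x.
Proof. exact: (perm_lift_basis (X := module_gset M)). Qed.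
End Counit.

Lemma perm_coeff_push_fst (G : topologicalGroupType) (X : discreteGSet G)
    (V : set G) (V_normal : open_normal V) (T : coset_space V) (x : X)
    (D : perm_module (prod_gset X (coset_gset V_normal T))) :
  perm_coeff x (push_fst _ _ D) =
  \sum_(t : T) perm_coeff ((x, t) : prod_gset X (coset_gset V_normal T)) D.
Proof.
pose Z := prod_gset X (coset_gset V_normal T).
pose total (E : perm_module Z) := \sum_(t : T) perm_coeff ((x, t) : Z) E.
have total_zmod : zmod_morphism total.
  move=> E F; rewrite /total -sumrB; apply: eq_bigr => t _; exact: raddfB.
pose total_add : {additive perm_module Z -> int} :=
  HB.pack total (GRing.isZmodMorphism.Build _ _ _ total_zmod).
apply: (perm_module_ext (u := perm_coeff x \o push_fst _ _) (v := total_add)).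
move=> [y s] /=; rewrite perm_lift_basis perm_coeff_basis /total.
rewrite (bigD1 s) //= big1 ?addr0 => [|t ts];
  rewrite perm_coeff_basis xpair_eqE.
  by rewrite eqxx andbT.
by rewrite [s == t]eq_sym (negPf ts) andbF.
Qed.

Lemma push_fst_surjective (G : topologicalGroupType) (X Y : discreteGSet G)
    (y : Y) (E : perm_module X) : exists D, push_fst X Y D = E.
Proof.
pose e (x : X) : perm_module (prod_gset X Y) :=
  perm_basis ((x, y) : prod_gset X Y).
exists (zlift e E).
apply: (freeg_additive_ext (u := push_fst X Y \o zlift e) (v := idfun)) => x /=.
by rewrite zliftU perm_lift_basis.
Qed.

(** The divisibility argument: the coefficient k would be divisible by the index
    of V in W for every open normal V in W. *)
Lemma projective_infinite_eq0 (G : topologicalGroupType)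
    (P : discreteGModType G) :
  profinite G -> infinite_set [set: G] -> projective P -> forall x : P, x = 0.
Proof.
move=> profG infG projP x; apply/eqP; apply: contraT => x0.
have [s sE] : exists s : {gmod P -> perm_module (module_gset P)},
    counit P \o s =1 idfun.
  apply: projP; apply: surjective_epimorphism => y.
  by exists (perm_basis (y : module_gset P)); exact: counit_basis.
have [y sy] : exists y : P, perm_coeff (y : module_gset P) (s x) != 0.
  apply: contrapT => /forallNP s0; move: x0; rewrite -[x](sE x) /=.
  have -> : s x = 0.
    apply/eqP/freeg_eqP => y; rewrite coeff0.
    by apply/eqP; apply: contrapT => /negP; exact: s0.
  by rewrite raddf0 eqxx.
pose U := [set g : G | gact g x = x] `&` [set g : G | gact g y = y].
have clU : clopen U by apply: clopenI; exact: clopen_stabilizer.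
have U1 : U 1%g by split; exact: gact1.
have [cptG _ _] := profG.
pose W := clopen_core U.
have W_normal : open_normal W by exact: clopen_core_open_normal.
have [S] := open_normal_coset_space cptG W_normal.
set k := perm_coeff _ _ in sy.
(* #|G : V| = #|G : W| * m with m the index of V in W, so this bound on
   #|G : V| forces m > `|k|. *)
have [V [V_normal VW V_large]] :=
  open_normal_large_index profG (#|S| * `|k|.+1)%N infG W_normal.
have [T] := open_normal_coset_space cptG V_normal.
have [] := projP _ _ (push_fst (module_gset P) (coset_gset V_normal T)) s.
  exact/surjective_epimorphism/push_fst_surjective/(coset_class T 1%g).
move=> h hs.
pose Z := prod_gset (module_gset P) (coset_gset V_normal T).
pose c (t : T) := perm_coeff ((y, t) : Z) (h x).
have ck : \sum_t c t = k by rewrite /k -hs /= perm_coeff_push_fst.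
have c_inv w t : W w -> c (coset_act w t) = c t.
  move=> /(clopen_core_sub U1)[/= wx wy].
  have := perm_coeff_gact w ((y, t) : Z) (h x); rewrite -gactE wx.
  by rewrite /= /prod_act /= wy.
have [q] := invariant_sum_divisible W_normal VW S c_inv.
rewrite ck; set m := #|_| => kqm.
have S_gt0 : (0 < #|S|)%N by apply/card_gt0P; exists (coset_class S 1%g).
have : (`|k|.+1 <= m)%N.
  by rewrite -(leq_pmul2l S_gt0) -(card_coset_space VW T S).
suff mk : (m <= `|k|)%N by rewrite ltnNge mk.
rewrite kqm -mulr_natr abszM natz absz_nat leq_pmull // absz_gt0.
by apply: contra_neq sy => q0; rewrite kqm q0 mul0rn.
Qed.

(** * The group ring of a finite group *)

Section Regular.
Variable G : topologicalGroupType.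
Hypotheses (hsG : hausdorff_space G) (finG : finite_set [set: G]).

Lemma regular_near (x : G) : \forall g \near (1%g : G), (g * x)%g = x.
Proof.
have cl1 : closed [set~ (1%g : G)].
  apply: (iffLR accessible_finite_set_closed).
    exact: hausdorff_accessible.
  exact: sub_finite_set finG.
have : nbhs (1%g : G) (~` [set~ 1%g]).
  by apply: open_nbhs_nbhs; split; [exact: closed_openC|apply].
by apply: filterS => g /= /contrapT ->; rewrite mul1g.
Qed.

Definition regular_gset : discreteGSet G :=
  DiscreteGSet (@mul1g G) (fun g h x => esym (mulgA g h x)) regular_near.

(** A morphism out of Z[G] is determined by the image of 1, which can be any
    element; lifting morphisms amounts to lifting that element. *)
Lemma regular_module_projective : projective (perm_module regular_gset).
Proof.
move=> M N e f /epimorphism_surjective e_surj.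
have [z ez] := e_surj (f (perm_basis (1%g : regular_gset))).
have z_gact (g x : regular_gset) : gact (sact g x) z = gact g (gact x z).
  exact: gactM.
exists (perm_lift_fun (X := regular_gset) z_gact).
apply: (perm_module_ext (X := regular_gset)
  (u := e \o perm_lift_fun (X := regular_gset) z_gact) (v := f)) => x /=.
rewrite (perm_lift_basis (X := regular_gset)) gactE ez -gactE gact_basis.
by rewrite /= mulg1.
Qed.

Lemma regular_module_neq0 : perm_basis (1%g : regular_gset) != 0.
Proof.
apply/eqP => /(congr1 (perm_coeff (1%g : regular_gset))).
by rewrite perm_coeff_basis eqxx raddf0.
Qed.
End Regular.

Theorem theorem2p1 (G : topologicalGroupType) (profG : profinite G) :
  (exists P : discreteGModType G, projective P /\ exists x : P, x != 0)
  <-> finite_set [set: G].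
Proof.
split=> [[P [projP [x x0]]]|finG].
  apply: contrapT => infG; move: x0.
  by rewrite (projective_infinite_eq0 profG infG projP x) eqxx.
have [_ hsG _] := profG.
exists (perm_module (regular_gset hsG finG)); split.
  exact: regular_module_projective.
exists (perm_basis (1%g : regular_gset hsG finG)).
exact: regular_module_neq0.
Qed.
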